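(* Let $A$ be a finite set with $|A|\ge 2$ and let $n\ge 2$. Every transformation $f:A^n\to A^n$ can be computed by a program of at most $4n-3$ instructions, i.e. $\mathcal{L}(f)\le 4n-3$.
   Context: A transformation of $A^n$ is a map $f=(f_1,\dots,f_n):A^n\to A^n$; its coordinate function $f_i:A^n\to A$ is trivial if $f_i(x)=x_i$ for all $x$. An instruction is a transformation of $A^n$ with at most one nontrivial coordinate function. A program of length $L$ computing $f$ is a sequence of instructions $g^1,\dots,g^L$ with $f=g^L\circ\cdots\circ g^1$. The procedural complexity $\mathcal{L}(f)$ is the shortest length of a program computing $f$; the identity has procedural complexity $0$. *)

(* Defs.v *)
From mathcomp Require Import all_boot.

Set Implicit Arguments.
Unset Strict Implicit.
Unset Printing Implicit Defensive.

(* The set A^n; coordinates are numbered 0, ..., n-1. *)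
Definition state (A : finType) (n : nat) : finType := {ffun 'I_n -> A}.

Definition transformation (A : finType) (n : nat) : Type :=
  state A n -> state A n.

Definition coordinate A n (f : transformation A n) (i : 'I_n) (x : state A n) : A :=
  f x i.

Definition trivial_coordinate A n (f : transformation A n) (i : 'I_n) : bool :=
  [forall x : state A n, coordinate f i x == x i].

Definition is_instruction A n (f : transformation A n) : bool :=
  #|[set i : 'I_n | ~~ trivial_coordinate f i]| <= 1.

Definition is_program A n (p : seq (transformation A n)) : bool :=
  all (@is_instruction A n) p.

(* For p = [:: g1; ...; gL] this is gL \o ... \o g1: the head of the list is
   executed first. *)
Definition composition A n (p : seq (transformation A n)) : transformation A n :=
  foldr (fun g h => h \o g) id p.

Definition computes A n (p : seq (transformation A n)) (f : transformation A n) : Prop :=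
  is_program p /\ f =1 composition p.

(* L is the minimum of the lengths of the programs computing f.  This is a
   relation because a minimum exists only if some program computes f. *)
Definition is_procedural_complexity A n (f : transformation A n) (L : nat) : Prop :=
  (exists2 p, computes p f & size p = L) /\
  (forall p, computes p f -> L <= size p).

(* Main.v *)
(* Write q for the cardinality of A.  We factor f as b o h o a, where a and b
   are permutations of A^n and h is treelike: for each i, the coordinates >= i
   of h x depend only on the coordinates >= i of x.

   Routing: if b is a permutation and h is treelike, then b o h is computed by
   updating the coordinates 0, 1, ..., n-1, ..., 1, 0 in this order.  Join the
   class of x to the class of b x, classes being taken up to coordinate 0: this
   bipartite multigraph is q-regular, hence has a proper edge colouring by A.
   Updating coordinate 0 to the colour of the edge h x, then the remaining
   coordinates (recursively, the colour being kept as a parameter), and finally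
   coordinate 0 to its value in b (h x) never merges distinct values of h x.
   Routing b o h and a (as a o id) in this way gives two programs of 2n-1
   instructions, and the last instruction of one merges with the first of the
   other.

   Factoring: only the kernel of h o a matters, since b is then found by
   counting.  Among any q integers some nonempty subset has its sum divisible
   by q, so the fibres of f can be grouped, at most q at a time, into unions of
   size divisible by q.  Cut each union into blocks of q points.  Coordinate 0
   of a is the position in the block, coordinate 0 of h o a tells apart the at
   most q fibres of a group, and the other coordinates come from the same
   construction applied to the set of blocks, partitioned by groups. *)
Require Import Defs.
From Stdlib Require Import Classical.
From mathcomp Require Import all_boot zify.

Set Implicit Arguments.
Unset Strict Implicit.
Unset Printing Implicit Defensive.

(** * Hall's theorem and bipartite edge colouring *)

(* Rado's proof: while some [N i] has two elements, one of them can be removed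
   without breaking the condition, because cardinality is submodular. *)
Lemma hall (I W : finType) (N : I -> {set W}) :
  (forall X : {set I}, #|X| <= #|\bigcup_(i in X) N i|) ->
  exists2 m : I -> W, injective m & forall i, m i \in N i.
Proof.
have [k] := ubnP (\sum_i #|N i|); elim: k N => // k IHk N ltk hallN.
have [/existsP [i ltN1]|] := boolP [exists i, 1 < #|N i|]; last first.
  rewrite negb_exists => /forallP leN1.
  have /fin_all_exists [m N1] i : exists w, N i = [set w].
    apply/cards1P; rewrite eqn_leq leqNgt leN1 /=.
    by have := hallN [set i]; rewrite big_set1 cards1.
  exists m => [i j eq_ij|i]; last by rewrite N1 set11.
  apply: contraTeq (hallN [set i; j]) => neq_ij.
  rewrite big_setU1 ?big_set1 ?inE //= cards2 neq_ij -ltnNge.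
  by rewrite !N1 eq_ij setUid cards1.
have /card_gt1P [x [y [Nx Ny neq_xy]]] := ltN1.
pose drop z j := if j == i then N i :\ z else N j.
have dropS z (X : {set I}) : i \notin X ->
    \bigcup_(j in X) drop z j = \bigcup_(j in X) N j.
  move=> iX; apply: eq_bigr => j jX; rewrite /drop ifN //.
  by apply: contraNneq iX => <-.
(* If removing [z] breaks the condition, the violating set contains [i]; [X] is that set without
   [i]. *)
have dropP z : z \in N i ->
    (exists2 m : I -> W, injective m & forall j, m j \in N j) \/
    exists2 X : {set I}, i \notin X &
      #|(N i :\ z) :|: \bigcup_(j in X) N j| <= #|X|.
  move=> Nz; have [/forallP hallD|] :=
      boolP [forall X : {set I}, #|X| <= #|\bigcup_(j in X) drop z j|].
    left; have [||m injm mP] := IHk (drop z).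
    - apply: leq_trans (ltk : _ <= k); rewrite (bigD1 i) //= [X in _ < X](bigD1 i) //=.
      rewrite {1}/drop eqxx [#|N i|](cardsD1 z) Nz add1n ltnS leq_add2l.
      by apply: leq_sum => j; rewrite /drop => /negbTE ->.
    - exact: hallD.
    exists m => // j; have := mP j; rewrite /drop.
    by case: eqP => // ->; rewrite inE => /andP [].
  rewrite negb_forall => /existsP [X]; rewrite -ltnNge => ltX.
  have iX : i \in X.
    by apply: contraLR ltX => iX; rewrite -leqNgt dropS.
  right; exists (X :\ i); first by rewrite !inE eqxx.
  move: ltX; rewrite -{1 2}(setD1K iX) big_setU1 ?inE ?eqxx //=.
  rewrite dropS ?inE ?eqxx // {1}/drop eqxx cardsU1 !inE eqxx /=.
  by rewrite add1n ltnS.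
have [//|[X iX leX]] := dropP x Nx.
have [//|[Y iY leY]] := dropP y Ny.
set NX := \bigcup_(j in X) N j in leX.
set NY := \bigcup_(j in Y) N j in leY.
have subU : \bigcup_(j in i |: (X :|: Y)) N j \subset
    ((N i :\ x) :|: NX) :|: ((N i :\ y) :|: NY).
  apply/bigcupsP => j; rewrite !inE => /or3P [/eqP ->|jX|jY].
  - apply/subsetP => z Nz; rewrite !inE Nz !andbT.
    by have [->|] := eqVneq z x; rewrite ?neq_xy ?orbT.
  - have jN : N j \subset NX by apply: (bigcup_sup j).
    by apply/subsetP => z zj; rewrite !inE (subsetP jN z zj) ?orbT.
  - have jN : N j \subset NY by apply: (bigcup_sup j).
    by apply/subsetP => z zj; rewrite !inE (subsetP jN z zj) ?orbT.
have subI : \bigcup_(j in X :&: Y) N j \subset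
    ((N i :\ x) :|: NX) :&: ((N i :\ y) :|: NY).
  apply/bigcupsP => j; rewrite inE => /andP [jX jY].
  by rewrite subsetI !subsetU ?(bigcup_sup j) ?orbT.
(* By Hall's condition for [i |: (X :|: Y)] and [X :&: Y], the union and the intersection of the two
   reduced neighbourhoods have together at least [#|X| + #|Y| + 1] elements; [leX] and [leY] allow
   one less. *)
have := leq_trans (hallN _) (subset_leq_card subU).
have := leq_trans (hallN _) (subset_leq_card subI).
rewrite cardsU1 !inE negb_or iX iY /=.
have := cardsUI X Y.
have := cardsUI ((N i :\ x) :|: NX) ((N i :\ y) :|: NY).
lia.
Qed.

(** An edge [e] joins [p e] on one side to [r e] on the other. In positive degree, counting edges
    gives Hall's condition, hence a perfect matching; it takes the largest colour, and removing it
    lowers every degree by one. *)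
Lemma regular_edge_coloring (E V : finType) (p r : E -> V) d (S : {set E}) :
  (forall v, #|[set e in S | p e == v]| = d) ->
  (forall v, #|[set e in S | r e == v]| = d) ->
  exists2 c : E -> nat, {in S, forall e, c e < d} &
    {in S &, forall e e', c e = c e' -> p e = p e' \/ r e = r e' -> e = e'}.
Proof.
elim: d S => [|d IHd] S regp regr.
  have S0 e : (e \in S) = false.
    by have /cards0_eq/setP/(_ e) := regp (p e); rewrite !inE eqxx andbT.
  by exists (fun=> 0) => [e|e e']; rewrite S0.
have cardS (s : E -> V) (X : {set V}) :
    (forall v, #|[set e in S | s e == v]| = d.+1) ->
    #|[set e in S | s e \in X]| = #|X| * d.+1.
  move=> regs; rewrite -sum_nat_const -sum1_card.
  rewrite (partition_big s (mem X)) => [|e]; last by rewrite inE => /andP [].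
  apply: eq_bigr => v Xv; rewrite -(regs v) -sum1_card; apply: eq_bigl => e.
  by rewrite !inE -andbA; case: eqP => [->|_]; rewrite ?andbF ?(Xv : v \in X).
have [X|m injm mP] := @hall V V (fun v => r @: [set e in S | p e == v]).
  rewrite -(leq_pmul2r (ltn0Sn d)) -(cardS p) // -(cardS r) //.
  apply/subset_leq_card/subsetP => e; rewrite !inE => /andP [Se Xe].
  rewrite Se /=; apply/bigcupP; exists (p e) => //.
  by apply: imset_f; rewrite inE Se /=.
have /fin_all_exists [t tP] v :
    exists e, [/\ e \in S, p e = v & r e = m v].
  by have /imsetP [e] := mP v; rewrite inE => /andP [Se /eqP pe] ->; exists e.
have injt : injective t.
  by move=> v w eqt; have [_ <- _] := tP v; have [_ <- _] := tP w; rewrite eqt.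
have [m' m'K mK] := injF_bij injm.
have tS v : t v \in S by have [] := tP v.
pose T := t @: setT.
(* The only edge of the matching [T] at [v] is [t (u v)]; [s] is [p] or [r], according to the
   side. *)
have cardT (s : E -> V) (u : V -> V) : (forall v, s (t (u v)) = v) ->
    (forall v, u (s (t v)) = v) ->
    (forall v, #|[set e in S | s e == v]| = d.+1) ->
    forall v, #|[set e in S :\: T | s e == v]| = d.
  move=> stu ust regs v; apply/eqP; rewrite -eqSS -(regs v).
  rewrite [X in _ == X](cardsD1 (t (u v))) !inE tS stu eqxx add1n eqSS.
  apply/eqP/eq_card => e; rewrite !inE.
  have [->|neq_e] := eqVneq e (t (u v)); first by rewrite imset_f ?inE.
  have [eqv|] := eqVneq (s e) v; rewrite ?andbF // !andbT.
  case: (e \in S); rewrite ?andbF // andbT.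
  apply: contra_neqN neq_e => /imsetP [w _ eqe].
  by rewrite eqe -eqv eqe ust.
have [||c cS cP] := IHd (S :\: T).
- by apply: (cardT p id) => // v; have [] := tP v.
- apply: (cardT r m') => // v; first by have [_ _ ->] := tP (m' v).
  by have [_ _ ->] := tP v.
have ltc e : e \in S -> e \notin T -> c e < d by move=> Se Te; apply: cS; rewrite inE Se Te.
exists (fun e => if e \in T then d else c e) => [e Se|e e' Se Se'].
  by case: ifPn => // Te; apply/ltnW/ltc.
case: ifPn => Te; case: ifPn => Te'.
- move=> _; move: Te Te' => /imsetP [v _ ->] /imsetP [w _ ->].
  have [_ -> ->] := tP v; have [_ -> ->] := tP w.
  by case=> [->|/injm ->].
- by move=> eqc; have := ltc _ Se' Te'; rewrite -eqc ltnn.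
- by move=> eqc; have := ltc _ Se Te; rewrite eqc ltnn.
- by apply: cP; rewrite inE ?Te ?Te'.
Qed.

(** * Zero sums modulo [q] and factoring through the kernel *)

Lemma zero_sum_subset (K : finType) (w : K -> nat) q (S : {set K}) :
  0 < q -> S != set0 -> q %| \sum_(y in S) w y ->
  exists T : {set K}, [/\ T != set0, T \subset S, #|T| <= q &
    q %| \sum_(y in T) w y].
Proof.
move=> q_gt0 S0 dvdS; have [leS|ltS] := leqP #|S| q; first by exists S.
pose W i := \sum_(y <- take i (enum S)) w y.
(* Pigeonhole: of the [q + 1] sums over prefixes of length 0 to [q], two agree modulo [q]; the
   segment between them is the subset sought. *)
pose F (i : 'I_q.+1) : 'I_q := Ordinal (ltn_pmod (W i) q_gt0).
have /injectivePn [i [j neq_ij eqF]] : ~~ injectiveb F.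
  apply/negP => /injectiveP/leq_card; by rewrite !card_ord ltnn.
wlog lt_ij : i j neq_ij eqF / i < j.
  move=> wl; have [|lt_ji|/val_inj eq_ij] := ltngtP i j; first exact: wl.
    by apply: (wl j i) => //; rewrite eq_sym.
  by rewrite eq_ij eqxx in neq_ij.
pose s := drop i (take j (enum S)).
have uniqs : uniq s by rewrite drop_uniq ?take_uniq ?enum_uniq.
have sizes : size s = j - i.
  rewrite size_drop size_takel // -cardE; have := ltn_ord j; lia.
exists [set y in s]; split.
- rewrite -card_gt0 cardsE (card_uniqP uniqs) sizes; lia.
- by apply/subsetP => y; rewrite inE => /mem_drop/mem_take; rewrite mem_enum.
- rewrite cardsE (card_uniqP uniqs) sizes; have := ltn_ord j; lia.
have -> : \sum_(y in [set y in s]) w y = W j - W i.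
  rewrite (eq_bigl (mem s)) => [|y]; last by rewrite inE.
  rewrite -big_uniq // /W -(cat_take_drop i (take j (enum S))).
  by rewrite (take_takel _ (ltnW lt_ij)) big_cat /= addKn.
have leW : W i <= W j.
  rewrite /W -(cat_take_drop i (take j (enum S))).
  by rewrite (take_takel _ (ltnW lt_ij)) big_cat /= leq_addr.
by rewrite -eqn_mod_dvd //; move/(congr1 val): eqF => /= ->.
Qed.

(** Zero-sum subsets are split off one at a time. [g] names a group by an element of [S], and [l]
    numbers the members within it. *)
Lemma zero_sum_grouping (K : finType) (w : K -> nat) q (S : {set K}) :
  0 < q -> q %| \sum_(y in S) w y ->
  exists (g : K -> K) (l : K -> nat),
    [/\ {in S, forall y, g y \in S}, {in S, forall y, l y < q},
        forall v, q %| \sum_(y in S | g y == v) w y &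
        {in S &, forall y z, g y = g z -> l y = l z -> y = z}].
Proof.
move=> q_gt0; have [k] := ubnP #|S|; elim: k S => // k IHk S ltS dvdS.
have [->|S0] := eqVneq S set0.
  exists id, (fun=> 0); split=> [y|y|v|y z]; rewrite ?inE //.
  by rewrite big_pred0 // => y; rewrite inE.
have [T [T0 TS leT dvdT]] := @zero_sum_subset K w q S q_gt0 S0 dvdS.
have /set0Pn [t Tt] := T0.
have sumS (P : pred K) : \sum_(y in S | P y) w y =
    \sum_(y in T | P y) w y + \sum_(y in S :\: T | P y) w y.
  rewrite (bigID (mem T)) /=; congr (_ + _); apply: eq_bigl => y; rewrite ?inE.
    case yT: (y \in T); rewrite ?andbF ?andbT //.
    by rewrite (subsetP TS).
  by case: (y \in T); rewrite ?andbF ?andbT.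
have [||g [l [gS lS dvdg gl]]] := IHk (S :\: T).
- have := cardsD S T; rewrite (setIidPr TS).
  move: T0 ltS (subset_leq_card TS); rewrite -card_gt0; lia.
- move: dvdS; have := sumS predT; rewrite !(eq_bigl _ _ (fun=> andbT _)) => ->.
  by rewrite dvdn_addr.
exists (fun y => if y \in T then t else g y),
  (fun y => if y \in T then index y (enum T) else l y); split=> [y Sy|y Sy|v|].
- case: ifPn => yT; first exact: (subsetP TS).
  by have /setDP [] : g y \in S :\: T by apply: gS; rewrite inE yT.
- case: ifPn => yT; last by apply: lS; rewrite inE yT.
  by rewrite (leq_trans _ leT) // cardE index_mem mem_enum.
- rewrite sumS dvdn_add //; last first.
    rewrite (eq_bigl (fun y => (y \in S :\: T) && (g y == v))) // => y.
    by rewrite inE; case: (y \in T).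
  have [<-|neq_v] := eqVneq t v.
    rewrite (eq_bigl (mem T)) // => y.
    by rewrite /=; case: ifP => // _; rewrite eqxx.
  by rewrite big_pred0 // => y; case: ifP => // _; rewrite (negbTE neq_v).
have gT y : y \in S -> y \notin T -> g y != t.
  move=> Sy yT; have : g y \in S :\: T by apply: gS; rewrite inE yT.
  by apply: contraTneq => ->; rewrite inE Tt.
move=> y z Sy Sz; case: ifPn => yT; case: ifPn => zT.
- by move=> _; apply: (index_inj y); rewrite mem_enum.
- by move=> eqg; have := gT z Sz zT; rewrite -eqg eqxx.
- by move=> eqg; have := gT y Sy yT; rewrite eqg eqxx.
- by apply: gl; rewrite inE ?yT ?zT.
Qed.

(** A nonempty fibre has at least [q] points, so a block of [q] points can be removed from it, which
    preserves divisibility. [r] is the number of the block, [d] the position in it. *)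
Lemma chop_fibres (X K : finType) (h : X -> K) q m (S : {set X}) :
  0 < q -> #|S| = m * q -> (forall v, q %| #|[set x in S | h x == v]|) ->
  exists r d : X -> nat,
    [/\ {in S, forall x, r x < m}, {in S, forall x, d x < q},
        {in S &, forall x y, r x = r y -> h x = h y} &
        {in S &, forall x y, r x = r y -> d x = d y -> x = y}].
Proof.
move=> q_gt0; elim: m S => [|m IHm] S cardS dvdS.
  have /cards0_eq -> : #|S| = 0 by [].
  by exists (fun=> 0), (fun=> 0); split=> x; rewrite inE.
have /set0Pn [x0 Sx0] : S != set0 by rewrite -card_gt0 cardS mulSn; lia.
set B := [set x in S | h x == h x0].
have leB : q <= #|B|.
  apply: dvdn_leq (dvdS _); rewrite card_gt0; apply/set0Pn; exists x0.
  by rewrite inE Sx0 /=.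
have [T] : exists2 T : {set X}, T \subset B & #|T| = q.
  exists [set x in take q (enum B)].
    by apply/subsetP => x; rewrite inE => /mem_take; rewrite mem_enum.
  by rewrite cardsE (card_uniqP _) ?take_uniq ?enum_uniq // size_takel -?cardE.
move=> TB cardT.
have TS : T \subset S.
  by apply: subset_trans TB _; apply/subsetP => x; rewrite inE => /andP [].
have hT x : x \in T -> h x = h x0.
  by move/(subsetP TB); rewrite inE => /andP [_ /eqP].
have [||r [d [rS dS rh rd]]] := IHm (S :\: T).
- by rewrite cardsD (setIidPr TS) cardS cardT mulSn addKn.
- move=> v; have -> : [set x in S :\: T | h x == v] = [set x in S | h x == v] :\: T.
    by apply/setP => x; rewrite !inE andbA.
  rewrite cardsD dvdn_sub //; have [<-|neq_v] := eqVneq (h x0) v.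
    by rewrite (setIidPr TB) cardT.
  rewrite (_ : _ :&: _ = set0) ?cards0 //; apply/setP => x; rewrite !inE.
  case xT: (x \in T); rewrite ?andbF // hT // (negbTE neq_v) andbF //.
have rm x : x \in S -> x \notin T -> r x < m.
  by move=> Sx xT; apply: rS; rewrite inE xT.
exists (fun x => if x \in T then m else r x),
  (fun x => if x \in T then index x (enum T) else d x).
split=> [x Sx|x Sx|x y Sx Sy|x y Sx Sy].
- by case: ifPn => // xT; apply/ltnW/rm.
- case: ifPn => xT; last by apply: dS; rewrite inE xT.
  by rewrite -cardT cardE index_mem mem_enum.
- case: ifPn => xT; case: ifPn => yT eqr.
  + by rewrite !hT.
  + by have := rm y Sy yT; rewrite -eqr ltnn.
  + by have := rm x Sx xT; rewrite eqr ltnn.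
  + by apply: rh; rewrite ?inE ?xT ?yT.
- case: ifPn => xT; case: ifPn => yT eqr.
  + by apply: (index_inj x); rewrite mem_enum.
  + by have := rm y Sy yT; rewrite -eqr ltnn.
  + by have := rm x Sx xT; rewrite eqr ltnn.
  + by apply: rd; rewrite ?inE ?xT ?yT.
Qed.

(* [D x i] is the coordinate [i] of [a x] and [J x i] that of [h (a x)]. *)
Lemma kernel_digits (A : finType) n (X K : finType) (f : X -> K) :
  0 < #|A| -> #|X| = #|A| ^ n ->
  exists D J : X -> nat -> A,
    [/\ forall x y, (forall i, i < n -> D x i = D y i) -> x = y,
        forall x y, (forall i, i < n -> J x i = J y i) <-> f x = f y &
        forall i x y, i < n ->
          (forall j, i <= j < n -> D x j = D y j) -> J x i = J y i].
Proof.
move=> A_gt0; have /card_gt0P [a0 _] := A_gt0.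
pose emb k := nth a0 (enum A) k.
have emb_inj k l : k < #|A| -> l < #|A| -> emb k = emb l -> k = l.
  by move=> ltk ltl /eqP; rewrite nth_uniq -?cardE ?enum_uniq // => /eqP.
elim: n X K f => [|n IHn] X K f cardX.
  have X1 (x y : X) : x = y.
    by have /card_le1_eqP := eq_leq cardX; apply.
  exists (fun _ _ => a0), (fun _ _ => a0); split=> // x y.
  by rewrite (X1 x y).
have sumf (P : pred K) :
    \sum_(y | P y) #|[set x | f x == y]| = #|[set x | P (f x)]|.
  rewrite -[RHS]sum1_card (partition_big f P) => [|x]; last by rewrite inE.
  apply: eq_bigr => y Py; rewrite -sum1_card; apply: eq_bigl => x.
  by rewrite !inE; case: eqP => [->|]; rewrite ?Py ?andbF.
have [||g [l [_ lq dvdg gl]]] :=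
    @zero_sum_grouping K (fun y => #|[set x | f x == y]|) #|A| setT => //.
  rewrite (eq_bigl predT) => [|y]; last by rewrite inE.
  by rewrite (sumf predT) cardsE cardX expnS dvdn_mulr.
have [|v|r [d [rlt dlt rgf rd]]] :=
    @chop_fibres X K (g \o f) #|A| (#|A| ^ n) setT A_gt0.
- by rewrite cardsT cardX expnSr.
- rewrite (_ : [set _ in _ | _] = [set x | g (f x) == v]); last first.
    by apply/setP => x; rewrite !inE.
  rewrite -(sumf [pred y | g y == v]).
  rewrite (eq_bigl (fun y => (y \in setT) && (g y == v))) => [|y].
    exact: dvdg.
  by rewrite !inE.
have /card_gt0P [x0 _] : 0 < #|X| by rewrite cardX expn_gt0 A_gt0.
pose r' x : 'I_(#|A| ^ n) := Ordinal (rlt x (in_setT x)).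
(* By [rgf] a block lies in a single group, so the choice of a point in it is immaterial; [x0] is a
   mere default. *)
pose f' v := g (f (odflt x0 [pick x | r' x == v])).
have f'r x : f' (r' x) = g (f x).
  rewrite /f'; case: pickP => [y /eqP/(congr1 val) eqr|/(_ x)] /=.
    by apply: rgf; rewrite ?inE.
  by rewrite eqxx.
have [|D [J [Dinj Jf' DJ]]] := IHn _ _ f'; first by rewrite card_ord.
pose D' x i := if i is i'.+1 then D (r' x) i' else emb (d x).
pose J' x i := if i is i'.+1 then J (r' x) i' else emb (l (f x)).
have D'inj x y : (forall i, i < n.+1 -> D' x i = D' y i) -> x = y.
  move=> eqD; apply: rd; rewrite ?inE //.
    by apply: (congr1 val (Dinj (r' x) (r' y) _)) => i; apply: (eqD i.+1).
  by apply: emb_inj (eqD 0 isT); apply: dlt; rewrite inE.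
exists D', J'; split=> // [x y|[|i] x y lti eqD].
- split=> [eqJ|eqf [_|i lti]] /=; last 2 first.
  + by rewrite eqf.
  + by apply: (proj2 (Jf' _ _)) => //; rewrite !f'r eqf.
  apply: gl; rewrite ?inE //.
    by rewrite -!f'r; apply/Jf' => i; apply: (eqJ i.+1).
  by apply: emb_inj (eqJ 0 isT); apply: lq; rewrite inE.
(* Coordinate 0 may depend on all the digits, and these determine the point. *)
- by rewrite (D'inj x y).
- by apply: DJ => // j; apply: (eqD j.+1).
Qed.

(** Sending [h x] to [f x] is a well-defined bijection between the images; their complements are
    equally large and are matched by enumeration. *)
Lemma same_kernel_factor (T : finType) (f h : T -> T) :
  (forall x y, h x = h y <-> f x = f y) ->
  exists2 b : T -> T, injective b & forall x, f x = b (h x).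
Proof.
move=> eqker; pose S := h @: setT; pose R := f @: setT.
have Sh x : h x \in S by rewrite imset_f.
have Rf x : f x \in R by rewrite imset_f.
have /fin_all_exists [s sP] y : exists x, y \in S -> h x = y.
  have [/imsetP [x _ ->]|_] := boolP (y \in S); first by exists x.
  by exists y.
have fs x : f (s (h x)) = f x by apply/eqker/sP.
have cardR : #|~: S| = #|~: R|.
  rewrite [LHS]cardsCs [RHS]cardsCs !setCK; congr (_ - _).
  have -> : R = (f \o s) @: S.
    apply/setP => y; apply/imsetP/imsetP => [[x _ ->]|[z /imsetP [x _ ->] ->]].
      by exists (h x) => //=; rewrite fs.
    by exists (s (h x)).
  rewrite card_in_imset // => y z Sy Sz /= /eqker.
  by rewrite !sP.
pose e y := nth y (enum (~: R)) (index y (enum (~: S))).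
have ltS y : y \notin S -> index y (enum (~: S)) < size (enum (~: R)).
  by move=> yS; rewrite -cardE -cardR cardE index_mem mem_enum inE.
have eR y : y \notin S -> e y \notin R.
  by move=> yS; have := mem_nth y (ltS y yS); rewrite mem_enum inE.
exists (fun y => if y \in S then f (s y) else e y) => [y z|x]; last first.
  by rewrite Sh fs.
case: ifPn => yS; case: ifPn => zS.
- by move/eqker; rewrite !sP.
- by move=> eqe; have := eR z zS; rewrite -eqe Rf.
- by move=> eqe; have := eR y yS; rewrite eqe Rf.
rewrite /e (set_nth_default z y) ?ltS // => /eqP.
rewrite nth_uniq ?enum_uniq ?ltS // => /eqP.
by apply: (index_inj y); rewrite mem_enum inE.
Qed.

(** * Programs with a prescribed order of updates *)

Section Programs.

Variables (A : finType) (n : nat).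
Implicit Types (f g h : transformation A n) (x y : state A n).

Definition only k f := forall x (i : 'I_n), nat_of_ord i != k -> f x i = x i.

Fixpoint along (s : seq nat) f : Prop :=
  if s is k :: s' then
    exists g h, [/\ only k g, along s' h & f =1 h \o g]
  else f =1 id.

Lemma along_ext s f f' : f =1 f' -> along s f -> along s f'.
Proof.
move=> eqf; case: s => [|k s] /=; first by move=> f1 x; rewrite -eqf.
by case=> g [h [gk hs fE]]; exists g, h; split=> // x; rewrite -eqf.
Qed.

Lemma along_cat s t f h : along s f -> along t h -> along (s ++ t) (h \o f).
Proof.
elim: s f => [|k s IHs] f /=.
  by move=> f1; apply: along_ext => x /=; rewrite f1.
case=> g [f' [gk fs fE]] ht; exists g, (h \o f'); split=> //; first exact: IHs.
by move=> x /=; rewrite fE.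
Qed.

Lemma along1 k g : only k g -> along [:: k] g.
Proof. by move=> gk; exists g, id. Qed.

(** This saves one instruction where two programs are joined. *)
Lemma along_merge s k t f : along (s ++ [:: k, k & t]) f -> along (s ++ k :: t) f.
Proof.
elim: s f => [|l s IHs] f /=.
  case=> g [h0 [gk [g' [h [gk' ht hE]]] fE]].
  exists (g' \o g), h; split=> // [x i neq_ik|x] /=; first by rewrite gk' ?gk.
  by rewrite fE /= hE.
by case=> g [h [gl hs fE]]; exists g, h; split=> //; apply: IHs.
Qed.

Lemma only_instruction k f : only k f -> is_instruction f.
Proof.
move=> fk; apply/card_le1_eqP => i j; rewrite !inE => nti ntj.
apply: val_inj; suff eqk l : ~~ trivial_coordinate f l -> l = k :> nat.
  by rewrite /= !eqk.
apply: contraNeq => neq_lk; apply/forallP => x; exact/eqP/fk.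
Qed.

Lemma along_computes s f : along s f ->
  exists2 p : seq (transformation A n), computes p f & size p = size s.
Proof.
elim: s f => [|k s IHs] f /=; first by move=> f1; exists [::].
case=> g [h [gk /IHs [p [insp hE] <-] fE]]; exists (g :: p) => //; split.
  by rewrite /is_program /= (only_instruction gk).
by move=> x; rewrite fE /= hE.
Qed.

(** * Routing: one pass up and down the coordinates *)

Definition upd k (x : state A n) (a : A) : state A n :=
  [ffun i : 'I_n => if nat_of_ord i == k then a else x i].

Definition agree_off k x y := forall i : 'I_n, nat_of_ord i != k -> x i = y i.

(* The vertices of the bipartite multigraph with edges [x] joining [x] to
   [b x] are the states up to coordinate [k]; it is regular of degree [#|A|]. *)
Lemma coordinate_coloring (k : 'I_n) (b : state A n -> state A n) :
  injective b -> 0 < #|A| ->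
  exists c : state A n -> A,
    forall x y, agree_off k x y \/ agree_off k (b x) (b y) -> c x = c y -> x = y.
Proof.
move=> injb A_gt0; have /card_gt0P [a0 _] := A_gt0.
have Pq x : upd k x a0 k == a0 by rewrite ffunE eqxx.
pose p x : {z : state A n | z k == a0} := exist _ (upd k x a0) (Pq x).
have pP x y : agree_off k x y -> p x = p y.
  move=> eqxy; apply: val_inj; apply/ffunP => i; rewrite !ffunE.
  by case: ifPn => // /eqxy.
have regp v : #|[set x | p x == v]| = #|A|.
  have -> : [set x | p x == v] = upd k (val v) @: setT.
    apply/setP => x; rewrite inE; apply/eqP/imsetP => [<-|[a _ ->]].
      exists (x k) => //; apply/ffunP => i; rewrite ffunE /= ffunE.
      by case: ifPn => [/eqP/val_inj ->|/negbTE ->].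
    apply: val_inj; apply/ffunP => i; rewrite /= !ffunE.
    case: ifPn => [/eqP/val_inj ->|/negbTE]; last by move=> ->.
    by have /eqP -> := valP v.
  rewrite card_imset ?cardsT // => a a' /ffunP/(_ k).
  by rewrite !ffunE eqxx.
have [v|v|c cA cP] := @regular_edge_coloring _ _ p (p \o b) #|A| setT.
- by rewrite -(regp v); apply: eq_card => x; rewrite !inE.
- rewrite -(regp v) -[RHS](card_preimset _ injb).
  by apply: eq_card => x; rewrite !inE.
exists (fun x => nth a0 (enum A) (c x)) => x y agr /eqP.
rewrite nth_uniq -?cardE ?enum_uniq ?cA ?inE // => /eqP eqc.
by apply: cP; rewrite ?inE //; case: agr => /pP /=; [left|right].
Qed.

Definition fixes_below k f := forall x (j : 'I_n), j < k -> f x j = x j.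

(* The coordinates below [k] act as parameters of a map on the others. *)
Definition treelike k f := forall i x y, k <= i ->
  (forall j : 'I_n, j < k \/ i <= j -> x j = y j) ->
  forall j : 'I_n, i <= j -> f x j = f y j.

Fixpoint updown d k :=
  if d is d'.+1 then k :: rcons (updown d' k.+1) k else [:: k].

Lemma size_updown d k : size (updown d k) = d.*2.+1.
Proof. by elim: d k => //= d IHd k; rewrite size_rcons IHd. Qed.

Lemma updown_head d k : exists s, updown d k = k :: s.
Proof. by case: d => [|d] /=; eexists. Qed.

Lemma updown_last d k : exists s, updown d k = rcons s k.
Proof.
case: d => [|d] /=; first by exists [::].
by exists (k :: updown d k.+1).
Qed.

Lemma along_updown d k b h : 0 < #|A| -> d + k.+1 = n ->
  injective b -> fixes_below k b -> fixes_below k h -> treelike k h ->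
  along (updown d k) (b \o h).
Proof.
move=> A_gt0; elim: d k b h => [|d IHd] k b h eqn injb fixb fixh treeh.
  (* Here [k] is the last coordinate, so all others lie below it and are fixed. *)
  apply: along1 => x i neq_ik /=.
  have ltik : i < k by have := ltn_ord i; lia.
  by rewrite fixb ?fixh.
have ltk : k < n by lia.
have [c cP] := coordinate_coloring (Ordinal ltk) injb A_gt0.
have updk (y : state A n) a : upd k y a (Ordinal ltk) = a by rewrite ffunE eqxx.
have upd_off (y : state A n) a (i : 'I_n) : nat_of_ord i != k -> upd k y a i = y i.
  by move=> neq_ik; rewrite ffunE (negbTE neq_ik).
have updI y z a a' : upd k y a = upd k z a' ->
    agree_off (Ordinal ltk) y z /\ a = a'.
  move=> equ; split=> [i neq_ik|]; last by rewrite -(updk y a) equ updk.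
  by rewrite -(upd_off y a) // equ upd_off.
(* With [z] standing for [h x], these are the states before and after the middle passage. The
   colouring makes both maps injective, hence invertible. *)
pose u z := upd k z (c z); pose w z := upd k (b z) (c z).
have injsu : injective u by move=> z z' /updI [agr]; apply: cP; left.
have injsw : injective w by move=> z z' /updI [agr]; apply: cP; right.
(* [first] stores the colour of [h x]; [h'] applies [h] off coordinate [k] and keeps the colour;
   [b'] sends [u z] to [w z]; [last] recovers [z] from [w z] and returns [b z]. *)
pose first x := upd k x (c (h x)).
pose last := b \o invF injsw.
pose b' := w \o invF injsu.
pose h' x := upd k (h x) (x (Ordinal ltk)).
have first_only : only k first by move=> x i neq_ik; rewrite upd_off.
have last_only : only k last.
  move=> x i neq_ik; rewrite -{2}[x](f_invF injsw).
  by rewrite /last /= upd_off.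
have ordk (j : 'I_n) : nat_of_ord j == k -> j = Ordinal ltk.
  by move/eqP => eqj; apply: val_inj.
have mid : along (updown d k.+1) (b' \o h').
  apply: IHd => [|x y|x j|x j|i x y ltki agr j leij]; first by lia.
  - by move/injsw/(can_inj (f_invF injsu)).
  - rewrite ltnS => lejk; rewrite -{2}[x](f_invF injsu) /b' /=.
    have [/ordk -> |neq_jk] := boolP (nat_of_ord j == k); first by rewrite !updk.
    by rewrite !upd_off // fixb // ltn_neqAle neq_jk.
  - rewrite ltnS => lejk.
    have [/ordk -> |neq_jk] := boolP (nat_of_ord j == k); first by rewrite updk.
    by rewrite upd_off // fixh // ltn_neqAle neq_jk.
  rewrite !upd_off; try lia; apply: treeh leij => [|l ltl]; first by lia.
  by apply: agr; case: ltl; [left; lia | right].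
have h'first x : h' (first x) = u (h x).
  apply/ffunP => i; have [/ordk ->|neq_ik] := boolP (nat_of_ord i == k).
    by rewrite !updk.
  rewrite !upd_off //; have [ltik|leki] := ltnP i k.
    by rewrite !fixh // first_only.
  (* The coordinates of [h x] above [k] do not involve coordinate [k], the only one that [first]
     changes. *)
  apply: (treeh k.+1) => [|j ltj|]; try lia.
  by apply: first_only; case: ltj; lia.
apply: (@along_ext _ (last \o ((b' \o h') \o first))) => [x|].
  by rewrite /= h'first /b' /= invF_f /last /= invF_f.
have -> : updown d.+1 k = (k :: updown d k.+1) ++ [:: k] by rewrite /= cats1.
apply: (along_cat _ (along1 last_only)).
exact: (along_cat (along1 first_only) mid).
Qed.

End Programs.

(** * Joining the two passes and counting *)

Lemma along_updown_twice (A : finType) m (f : transformation A m.+1) :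
  0 < #|A| ->
  exists2 s, along s f & size s = 4 * m + 1.
Proof.
move=> A_gt0.
have [|D [J [Dinj Jf DJ]]] := @kernel_digits A m.+1 _ _ f A_gt0.
  by rewrite card_ffun card_ord.
pose a x : state A m.+1 := [ffun i => D x (nat_of_ord i)].
have aE x (i : 'I_m.+1) : a x i = D x i by rewrite ffunE.
have inja : injective a.
  by move=> x y eqa; apply: Dinj => i lti; rewrite -!(aE _ (Ordinal lti)) eqa.
(* The digits [J x] are read as a function of [a x]; [DJ] then says that [h] is treelike. *)
pose h y : state A m.+1 := [ffun i => J (invF inja y) (nat_of_ord i)].
have hE x (i : 'I_m.+1) : h (a x) i = J x i by rewrite ffunE invF_f.
have [x y|b injb fE] := @same_kernel_factor _ f (h \o a).
  rewrite -Jf; split=> [/= eqh i lti|eqJ].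
    by rewrite -!(hE _ (Ordinal lti)) eqh.
  by apply/ffunP => i; rewrite /= !hE eqJ.
have alonga : along (updown m 0) (a \o id).
  by apply: along_updown => //; [lia | move=> i x y _ agr j leij; apply: agr; right].
have alongb : along (updown m 0) (b \o h).
  apply: along_updown => // [|i x y _ agr j leij]; first by lia.
  rewrite -[x](f_invF inja) -[y](f_invF inja) !hE; apply: DJ => // l /andP [lel ltl].
  have := agr (Ordinal ltl) (or_intror (leq_trans leij lel)).
  by rewrite -{1}[x](f_invF inja) -{1}[y](f_invF inja) !aE.
have := along_cat alonga alongb.
have [s eqs] := updown_last m 0; have [t eqt] := updown_head m 0.
(* The two lists of [2 * m + 1] updates meet at coordinate 0, where two updates become one; with
   [n = m + 1] the total [4 * m + 1] is [4 * n - 3]. *)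
rewrite {1}eqs eqt cat_rcons => /along_merge alongf; exists (s ++ 0 :: t).
  by apply: along_ext alongf => x; rewrite fE.
have := size_updown m 0; rewrite {1}eqs size_rcons => ss.
have := size_updown m 0; rewrite eqt size_cat /= => st.
lia.
Qed.

(** For an arbitrary [P], the case distinction on a smaller witness is classical. *)
Lemma ex_minimum (P : nat -> Prop) L :
  P L -> exists2 M, P M /\ (forall N, P N -> M <= N) & M <= L.
Proof.
elim/ltn_ind: L => L IHL PL.
have [[N [PN ltNL]]|minL] := classic (exists N, P N /\ N < L).
  have [M MP leMN] := IHL N ltNL PN.
  by exists M => //; apply: leq_trans leMN (ltnW ltNL).
exists L => //; split=> // N PN; rewrite leqNgt; apply/negP => ltNL.
by apply: minL; exists N.
Qed.

Theorem theorem3 (A : finType) (n : nat) (hA : 2 <= #|A|) (hn : 2 <= n)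
    (f : transformation A n) :
  (exists2 p : seq (transformation A n), computes p f & size p <= 4 * n - 3) /\
  (exists2 L : nat, is_procedural_complexity f L & L <= 4 * n - 3).
Proof.
have [p pf lep] : exists2 p : seq (transformation A n),
    computes p f & size p <= 4 * n - 3.
  case: n hn f => // m _ f.
  have [s /along_computes [p pf sp] ss] := along_updown_twice f (ltnW hA).
  by exists p => //; lia.
split; first by exists p.
have [|L [exL minL] leL] :=
    @ex_minimum (fun L => exists2 p, computes p f & size p = L) (size p).
  by exists p.
exists L; last exact: leq_trans leL lep.
by split=> // q qf; apply: minL; exists q.
Qed.
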